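(* Let the problem data, $\Sigma_0$, $P_f\succ0$, the multiplier cone $\mathcal M$, multipliers $M_0,\dots,M_{N-1}\in\mathcal M$, symmetric positive definite matrices $P_0,\dots,P_N\in\mathbb R^{(1+n)\times(1+n)}$, gains $K_0,\dots,K_{N-1}\in\mathbb R^{m\times(1+n)}$ and $\nu>0$ be as in the context. Define $$\widetilde P_k:=P_k^{-1},\quad\widetilde K_k:=K_kP_k^{-1},\quad\tilde\nu:=\nu^{-1},\quad Z:=\nu^{-2}\sqrt{\Sigma_0}\,P_0\sqrt{\Sigma_0},\quad \widetilde M_k:=M_k^{-1}=\begin{pmatrix}\widetilde M_k^{11}&\widetilde M_k^{12}\\ \widetilde M_k^{21}&\widetilde M_k^{22}\end{pmatrix}$$ ($Z$ playing the role of a slack variable), partition $\widetilde P_k=\begin{pmatrix}\tilde p_k^{11}&\tilde p_k^{12}\\ \tilde p_k^{21}&\widetilde P_k^{22}\end{pmatrix}$, $\widetilde K_k=\begin{pmatrix}\tilde k_k^1&\widetilde K_k^2\end{pmatrix}$, let $$\widetilde Q_k:=T_k\begin{pmatrix}\widetilde M_k^{22}&0&0&\widetilde M_k^{21}\\ 0&\widetilde P_{k+1}&0&0\\ 0&0&I&0\\ \widetilde M_k^{12}&0&0&\widetilde M_k^{11}\end{pmatrix}T_k^\top,\qquad T_k:=\begin{pmatrix}0&1&0&0&0\\ B_k^2&0&I&0&0\\ D_k^{12}&0&0&I&0\\ D_k^{32}&0&0&0&I\end{pmatrix}$$ (the second and third block columns of $T_k$ together correspond to $\widetilde P_{k+1}$),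 and $$\begin{pmatrix}\tilde f_k^K&\widetilde A_k^K\\ \tilde g_k^{1K}&\widetilde C_k^{1K}\\ \tilde g_{ki}^{2K}&\widetilde C_{ki}^{2K}\\ \tilde g_k^{3K}&\widetilde C_k^{3K}\end{pmatrix}:=\begin{pmatrix}f_k&A_k&B_k^1\\ g_k^1&C_k^1&D_k^{11}\\ g_{ki}^2&C_{ki}^2&D_{ki}^{21}\\ g_k^3&C_k^3&D_k^{31}\end{pmatrix}\begin{pmatrix}\tilde p_k^{11}&\tilde p_k^{12}\\ \tilde p_k^{21}&\widetilde P_k^{22}\\ \tilde k_k^1&\widetilde K_k^2\end{pmatrix},\qquad \widetilde Y_k:=\begin{pmatrix}\tilde p_k^{11}&\tilde p_k^{12}\\ \tilde f_k^K&\widetilde A_k^K\\ \tilde g_k^{1K}&\widetilde C_k^{1K}\\ \tilde g_k^{3K}&\widetilde C_k^{3K}\end{pmatrix}.$$ Then the matrix inequalities (R1), (P2), (P3), (P4), (R1) $E_k^\top\mathcal N_kE_k\preceq0$ for $k=0,\dots,N-1$, with $$\mathcal N_k=\begin{pmatrix}-P_k&0&0&0&0\\ 0&M_k^{22}&0&0&M_k^{21}\\ 0&0&P_{k+1}&0&0\\ 0&0&0&I&0\\ 0&M_k^{12}&0&0&M_k^{11}\end{pmatrix},\quad E_k=\begin{pmatrix}1&0&0\\ 0&I&0\\ 0&0&I\\ 1&0&0\\ f_k^K&A_k^K&B_k^2\\ g_k^{1K}&C_k^{1K}&D_k^{12}\\ g_k^{3K}&C_k^{3K}&D_k^{32}\end{pmatrix};$$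 (P2) $\nu\ge\mathrm{trace}(P_0\Sigma_0)$; (P3) $P_N\succeq P_f$; (P4) $P_k\succeq\nu\begin{pmatrix}g_{ki}^{2K}&C_{ki}^{2K}\end{pmatrix}^\top\begin{pmatrix}g_{ki}^{2K}&C_{ki}^{2K}\end{pmatrix}$ for $k=0,\dots,N-1$, $i=1,\dots,s$; are equivalent to the linear matrix inequalities (LR1), (L2), (L3), (L4): (LR1) $\begin{pmatrix}\widetilde Q_k&\widetilde Y_k\\ \widetilde Y_k^\top&\widetilde P_k\end{pmatrix}\succeq0$ for $k=0,\dots,N-1$; (L2) $\begin{pmatrix}\widetilde P_0&\tilde\nu\sqrt{\Sigma_0}\\ \tilde\nu\sqrt{\Sigma_0}^\top&Z\end{pmatrix}\succeq0$ and $\mathrm{trace}\,Z\le\tilde\nu$; (L3) $\widetilde P_N\preceq P_f^{-1}$; (L4) $\begin{pmatrix}\tilde p_k^{11}&\tilde p_k^{12}&(\tilde g_{ki}^{2K})^\top\\ \tilde p_k^{21}&\widetilde P_k^{22}&(\widetilde C_{ki}^{2K})^\top\\ \tilde g_{ki}^{2K}&\widetilde C_{ki}^{2K}&\tilde\nu I\end{pmatrix}\succeq0$ for $k=0,\dots,N-1$, $i=1,\dots,s$.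
   Context: Fix $N,n,m,l,r,s\in\mathbb N$. The data are real matrices/vectors of compatible sizes describing, for $k=0,\dots,N-1$ and $i=1,\dots,s$, the uncertain system with state $x_k\in\mathbb R^n$, input $u_k\in\mathbb R^m$, disturbance $w_k\in\mathbb R^l$: $x_{k+1}=f_k+A_kx_k+B_k^1u_k+B_k^2w_k$, $y_k=g_k^1+C_k^1x_k+D_k^{11}u_k+D_k^{12}w_k$, $v_{ki}=g_{ki}^2+C_{ki}^2x_k+D_{ki}^{21}u_k$, $z_k=g_k^3+C_k^3x_k+D_k^{31}u_k+D_k^{32}w_k\in\mathbb R^r$. $P_f\in\mathbb R^{(1+n)\times(1+n)}$ is symmetric positive definite, $\bar x\in\mathbb R^n$, $\Sigma_0:=\begin{pmatrix}1\\ \bar x\end{pmatrix}\begin{pmatrix}1\\ \bar x\end{pmatrix}^\top$ with positive semidefinite square root $\sqrt{\Sigma_0}$. $\mathcal M$ is a convex cone of symmetric matrices $M=\begin{pmatrix}M^{11}&M^{12}\\ M^{21}&M^{22}\end{pmatrix}\in\mathbb R^{(r+l)\times(r+l)}$, $M^{11}\in\mathbb R^{r\times r}$, $M^{22}\in\mathbb R^{l\times l}$, such that every $M\in\mathcal M$ is invertible with $M^{11}\succ0$ and $M^{22}\prec0$, and such that the inverses of its elements lie in another convex cone $\mathcal M'$. Inverses $\widetilde M$ are partitioned in the same way as $M$. Gains are partitioned as $K_k=\begin{pmatrix}k_k^1&K_k^2\end{pmatrix}$ with $k_k^1\in\mathbb R^m$, $K_k^2\in\mathbb R^{m\times n}$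 (policy $u_k=k_k^1+K_k^2x_k$), and $$\begin{pmatrix}f_k^K&A_k^K\\ g_k^{1K}&C_k^{1K}\\ g_{ki}^{2K}&C_{ki}^{2K}\\ g_k^{3K}&C_k^{3K}\end{pmatrix}:=\begin{pmatrix}f_k&A_k&B_k^1\\ g_k^1&C_k^1&D_k^{11}\\ g_{ki}^2&C_{ki}^2&D_{ki}^{21}\\ g_k^3&C_k^3&D_k^{31}\end{pmatrix}\begin{pmatrix}1&0\\ 0&I\\ k_k^1&K_k^2\end{pmatrix}.$$ Matrices $\widetilde P_k$ are partitioned with $\tilde p_k^{11}\in\mathbb R$, $\widetilde P_k^{22}\in\mathbb R^{n\times n}$. $\succeq,\preceq$ denote the Loewner order.
   Formalization: The first block column of T_k is taken with a minus sign, −(0; B_k^2; D_k^12; D_k^32); with the printed plus sign the equivalence of (R1)–(P4) with (LR1)–(L4) fails in general when M_k^12 is nonzero. *)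

(* Defs.v *)
(* MathComp matrices over the reals ([R : realType]).  A vector (1, x) of
   R^(1+n) has its constant coordinate first.  Loewner inequalities and
   definiteness always include symmetry. *)
From HB Require Import structures.
From mathcomp Require Import all_boot all_order all_algebra.
From mathcomp Require Import all_classical all_reals.

Set Implicit Arguments.
Unset Strict Implicit.
Unset Printing Implicit Defensive.

Import Order.TTheory GRing.Theory Num.Theory.
Local Open Scope ring_scope.

Definition psdmx (R : realType) (n : nat) (A : 'M[R]_n) : Prop :=
  A^T = A /\ forall x : 'cV[R]_n, 0 <= (x^T *m A *m x) 0 0.

Definition posdefmx (R : realType) (n : nat) (A : 'M[R]_n) : Prop :=
  A^T = A /\ forall x : 'cV[R]_n, x != 0 -> 0 < (x^T *m A *m x) 0 0.

Definition negdefmx (R : realType) (n : nat) (A : 'M[R]_n) : Prop :=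
  posdefmx (- A).

Definition loewner_le (R : realType) (n : nat) (A B : 'M[R]_n) : Prop :=
  psdmx (B - A).

(* By uniqueness of the positive semidefinite square root, this relation
   determines [S]. *)
Definition psd_sqrt_of (R : realType) (n : nat) (A S : 'M[R]_n) : Prop :=
  psdmx S /\ S *m S = A.

(* Zero need not belong to the cone: multiplier cones consist of invertible
   matrices. *)
Definition convex_cone (R : realType) (n : nat) (C : set 'M[R]_n) : Prop :=
  forall (A B : 'M[R]_n) (a b : R),
    C A -> C B -> 0 < a -> 0 < b -> C (a *: A + b *: B).

(* M11, M12, M21, M22 are [ulsubmx M], [ursubmx M], [dlsubmx M],
   [drsubmx M]. *)
Definition multiplier_cone (R : realType) (r l : nat)
    (C C' : set 'M[R]_(r + l)) : Prop :=
  [/\ convex_cone C, convex_cone C' &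
      forall M, C M ->
        [/\ M^T = M, M \in unitmx, posdefmx (ulsubmx M),
            negdefmx (drsubmx M) & C' (invmx M)]].

(* The sizes of the outputs y_k and v_ki are not prescribed, and may depend on
   the indices: [q k] and [t k i]. *)
Record uncertain_system (R : realType) (N n m l r s : nat)
    (q : 'I_N -> nat) (t : 'I_N -> 'I_s -> nat) := UncertainSystem {
  sys_f : forall k : 'I_N, 'cV[R]_n;
  sys_A : forall k : 'I_N, 'M[R]_n;
  sys_B1 : forall k : 'I_N, 'M[R]_(n, m);
  sys_B2 : forall k : 'I_N, 'M[R]_(n, l);
  sys_g1 : forall k : 'I_N, 'cV[R]_(q k);
  sys_C1 : forall k : 'I_N, 'M[R]_(q k, n);
  sys_D11 : forall k : 'I_N, 'M[R]_(q k, m);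
  sys_D12 : forall k : 'I_N, 'M[R]_(q k, l);
  sys_g2 : forall (k : 'I_N) (i : 'I_s), 'cV[R]_(t k i);
  sys_C2 : forall (k : 'I_N) (i : 'I_s), 'M[R]_(t k i, n);
  sys_D21 : forall (k : 'I_N) (i : 'I_s), 'M[R]_(t k i, m);
  sys_g3 : forall k : 'I_N, 'cV[R]_r;
  sys_C3 : forall k : 'I_N, 'M[R]_(r, n);
  sys_D31 : forall k : 'I_N, 'M[R]_(r, m);
  sys_D32 : forall k : 'I_N, 'M[R]_(r, l)
}.

Definition Sigma0 (R : realType) (n : nat) (xbar : 'cV[R]_n) : 'M[R]_(1 + n) :=
  col_mx (1%:M : 'M[R]_1) xbar *m (col_mx (1%:M : 'M[R]_1) xbar)^T.

(* One block row (h H G) of the open-loop data times the stacked matrix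
   (X ; K).  With [X = 1%:M] this is the closed-loop row (h^K H^K); with X, K
   replaced by P~, K~ it is the row (h~^K H~^K). *)
Definition loop_row (R : realType) (n m p : nat)
    (h : 'cV[R]_p) (H : 'M[R]_(p, n)) (G : 'M[R]_(p, m))
    (X : 'M[R]_(1 + n)) (K : 'M[R]_(m, 1 + n)) : 'M[R]_(p, 1 + n) :=
  row_mx (row_mx h H) G *m col_mx X K.

Section Loop.
Variables (R : realType) (N n m l r s : nat).
Variables (q : 'I_N -> nat) (t : 'I_N -> 'I_s -> nat).
Variable sys : @uncertain_system R N n m l r s q t.
Variables (k : 'I_N) (X : 'M[R]_(1 + n)) (K : 'M[R]_(m, 1 + n)).

Definition rowF : 'M[R]_(n, 1 + n) :=
  loop_row (sys_f sys k) (sys_A sys k) (sys_B1 sys k) X K.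
Definition rowG1 : 'M[R]_(q k, 1 + n) :=
  loop_row (sys_g1 sys k) (sys_C1 sys k) (sys_D11 sys k) X K.
Definition rowG2 (i : 'I_s) : 'M[R]_(t k i, 1 + n) :=
  loop_row (sys_g2 sys k i) (sys_C2 sys k i) (sys_D21 sys k i) X K.
Definition rowG3 : 'M[R]_(r, 1 + n) :=
  loop_row (sys_g3 sys k) (sys_C3 sys k) (sys_D31 sys k) X K.
End Loop.

(* / M22 0 0 M21 \
   |  0  P 0  0  |
   |  0  0 I  0  |
   \ M12 0 0 M11 /  *)
Definition mid_mx (R : realType) (n l r q : nat)
    (M : 'M[R]_(r + l)) (P : 'M[R]_(1 + n)) :
    'M[R]_(l + ((1 + n) + (q + r))) :=
  block_mx (drsubmx M) (row_mx 0 (row_mx 0 (dlsubmx M)))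
           (col_mx 0 (col_mx 0 (ursubmx M)))
           (block_mx P 0 0 (block_mx (1%:M : 'M[R]_q) 0 0 (ulsubmx M))).

Definition N_mx (R : realType) (n l r q : nat)
    (M : 'M[R]_(r + l)) (P Pnext : 'M[R]_(1 + n)) :
    'M[R]_((1 + n) + (l + ((1 + n) + (q + r)))) :=
  block_mx (- P) 0 0 (mid_mx q M Pnext).

Section Blocks.
Variables (R : realType) (N n m l r s : nat).
Variables (q : 'I_N -> nat) (t : 'I_N -> 'I_s -> nat).
Variable sys : @uncertain_system R N n m l r s q t.
Variable k : 'I_N.

(* The block rows (1 0 0) and (f^K A^K B2) of E_k are grouped into one block of
   1 + n rows, matching P_(k+1); the column blocks "1" and "I" acting on (1, x)
   are likewise grouped into 1 + n columns. *)
Definition e0 : 'M[R]_(1, 1 + n) := row_mx 1%:M 0.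

Definition E_mx (K : 'M[R]_(m, 1 + n)) :
    'M[R]_((1 + n) + (l + ((1 + n) + (q k + r))), (1 + n) + l) :=
  col_mx (row_mx 1%:M 0)
 (col_mx (row_mx 0 1%:M)
 (col_mx (col_mx (row_mx e0 0)
                 (row_mx (rowF sys k 1%:M K) (sys_B2 sys k)))
         (col_mx (row_mx (rowG1 sys k 1%:M K) (sys_D12 sys k))
                 (row_mx (rowG3 sys k 1%:M K) (sys_D32 sys k))))).

(* The disturbance column carries a minus sign: T_k annihilates the
   disturbance columns (I ; 0 ; B2 ; D12 ; D32) of E_k, which is what makes
   T_k diag(..) T_k^T the dual of the original quadratic form.  With a plus
   sign the dual form has the wrong sign on the cross terms in M~12 and M~21,
   and the equivalence fails as soon as M12 <> 0.  Negating M~12 and M~21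
   instead gives the same Q~_k. *)
Definition T_mx : 'M[R]_((1 + n) + (q k + r), l + ((1 + n) + (q k + r))) :=
  row_mx (- col_mx (col_mx 0 (sys_B2 sys k))
                   (col_mx (sys_D12 sys k) (sys_D32 sys k)))
         1%:M.

Definition Q_tilde (Mt : 'M[R]_(r + l)) (Ptnext : 'M[R]_(1 + n)) :
    'M[R]_((1 + n) + (q k + r)) :=
  T_mx *m mid_mx (q k) Mt Ptnext *m T_mx^T.

Definition Y_tilde (Pt : 'M[R]_(1 + n)) (Kt : 'M[R]_(m, 1 + n)) :
    'M[R]_((1 + n) + (q k + r), 1 + n) :=
  col_mx (col_mx (usubmx Pt) (rowF sys k Pt Kt))
         (col_mx (rowG1 sys k Pt Kt) (rowG3 sys k Pt Kt)).
End Blocks.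

(* k and k + 1 among the indices 0, ..., N. *)
Definition idx (N : nat) (k : 'I_N) : 'I_N.+1 := widen_ord (leqnSn N) k.
Definition idxS (N : nat) (k : 'I_N) : 'I_N.+1 := lift ord0 k.

(* Main.v *)
(* Write the column space of E_k as the graph of (W D) over (x, w).
   Completing the square in N_k, whose lower right block is positive definite and
   whose upper left block is negative definite, turns both E_k^T N_k E_k <= 0 and
   the dual inequality T N_k^-1 T^T >= 0, with T annihilating E_k, into the
   nonnegativity of the two Schur complements of one block matrix.  The dual
   inequality is in turn the Schur complement of (LR1) with respect to P~_k.
   The other three equivalences are Schur complements followed by a congruence;
   in (L2) the slack Z makes the Schur complement vanish. *)
Require Import Defs.
From HB Require Import structures.
From mathcomp Require Import all_boot all_order all_algebra.
From mathcomp Require Import all_classical all_reals.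

Set Implicit Arguments.
Unset Strict Implicit.
Unset Printing Implicit Defensive.

Import Order.TTheory GRing.Theory Num.Theory.
Local Open Scope ring_scope.


(** * Congruence, inverses and block diagonals of definite matrices *)

Section Definiteness.
Variable R : realType.

Lemma psdmx_congr (n p : nat) (A : 'M[R]_n) (L : 'M[R]_(n, p)) :
  psdmx A -> psdmx (L^T *m A *m L).
Proof.
move=> [sA pA]; split; first by rewrite !trmx_mul trmxK sA mulmxA.
by move=> x; have := pA (L *m x); rewrite trmx_mul !mulmxA.
Qed.

Lemma psdmx_congr_unit (n : nat) (A L : 'M[R]_n) :
  L \in unitmx -> psdmx (L^T *m A *m L) <-> psdmx A.
Proof.
move=> uL; split=> [|/psdmx_congr]; last exact.
move=> /(psdmx_congr (invmx L)).
by rewrite trmx_inv !mulmxA mulVmx ?unitmx_tr // mul1mx -mulmxA mulmxV ?mulmx1.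
Qed.

Lemma posdefmx_psd (n : nat) (A : 'M[R]_n) : posdefmx A -> psdmx A.
Proof.
move=> [sA pA]; split=> // x; have [->|/pA/ltW //] := eqVneq x 0.
by rewrite mulmx0 mxE.
Qed.

(** A nonzero row vector in the left kernel would make the form vanish at its transpose. *)
Lemma posdefmx_unit (n : nat) (A : 'M[R]_n) : posdefmx A -> A \in unitmx.
Proof.
move=> [_ pA]; rewrite unitmxE unitfE; apply/negP => /det0P [v v0 vA].
suff /pA : v^T != 0 by rewrite trmxK vA mul0mx mxE ltxx.
by apply: contraNneq v0 => vT0; rewrite -[v]trmxK vT0 trmx0.
Qed.

(** The form of A^-1 at x is the form of A at A^-1 x. *)
Lemma posdefmx_inv (n : nat) (A : 'M[R]_n) : posdefmx A -> posdefmx (invmx A).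
Proof.
move=> dA; have uA := posdefmx_unit dA; case: dA => sA pA.
have sAi : (invmx A)^T = invmx A by rewrite trmx_inv sA.
split=> // x x0; have := pA (invmx A *m x).
rewrite trmx_mul sAi !mulmxA mulmxKV //; apply.
by apply: contraNneq x0 => e; rewrite -[x](mulKVmx uA) e mulmx0.
Qed.

Lemma posdefmx_scalar (n : nat) (a : R) : 0 < a -> posdefmx (a%:M : 'M[R]_n).
Proof.
move=> a0; split=> [|x x0]; first exact: tr_scalar_mx.
rewrite mul_mx_scalar -scalemxAl mxE pmulr_rgt0 // mxE.
have nn i : true -> 0 <= x^T 0 i * x i 0 by rewrite mxE -expr2 sqr_ge0.
rewrite lt_neqAle sumr_ge0 // andbT eq_sym.
apply: contraNneq x0 => /(psumr_eq0P nn) e; apply/eqP/colP => i.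
by have /eqP := e i isT; rewrite !mxE mulf_eq0 orbb => /eqP.
Qed.

Lemma posdefmxD_psd (n : nat) (A B : 'M[R]_n) :
  posdefmx A -> psdmx B -> posdefmx (A + B).
Proof.
move=> [sA pA] [sB pB]; split; first by rewrite linearD /= sA sB.
move=> x x0; rewrite mulmxDr mulmxDl mxE; exact: ltr_wpDr (pB x) (pA x x0).
Qed.

Lemma quad_block_diag (n p : nat) (A : 'M[R]_n) (B : 'M[R]_p)
    (x : 'cV[R]_n) (y : 'cV[R]_p) :
  (col_mx x y)^T *m block_mx A 0 0 B *m col_mx x y
    = x^T *m A *m x + y^T *m B *m y.
Proof.
by rewrite tr_col_mx mul_row_block !mulmx0 addr0 add0r mul_row_col.
Qed.

Lemma posdefmx_block_diag (n p : nat) (A : 'M[R]_n) (B : 'M[R]_p) :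
  posdefmx A -> posdefmx B -> posdefmx (block_mx A 0 0 B).
Proof.
move=> dA dB; have [_ pA] := posdefmx_psd dA; have [_ pB] := posdefmx_psd dB.
case: dA dB => sA dA [sB dB].
split=> [|x]; first by rewrite tr_block_mx !trmx0 sA sB.
rewrite -[x]vsubmxK col_mx_eq0 negb_and quad_block_diag mxE.
by case/orP => [/dA|/dB] h; [apply: ltr_wpDr|apply: ltr_wpDl].
Qed.

Lemma psdmx_block_diag (n p : nat) (A : 'M[R]_n) (B : 'M[R]_p) :
  psdmx (block_mx A 0 0 B) <-> psdmx A /\ psdmx B.
Proof.
split=> [[sAB pAB] | [[sA pA] [sB pB]]].
  move: sAB; rewrite tr_block_mx !trmx0 => /eq_block_mx [sA _ _ sB].
  split; split=> // x.
    by have := pAB (col_mx x 0); rewrite quad_block_diag mulmx0 addr0.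
  by have := pAB (col_mx 0 x); rewrite quad_block_diag mulmx0 add0r.
split=> [|x]; first by rewrite tr_block_mx !trmx0 sA sB.
by rewrite -[x]vsubmxK quad_block_diag mxE addr_ge0.
Qed.

(** * Schur complements as block triangular congruences *)

Lemma unitmx_lblock (n p : nat) (B : 'M[R]_(p, n)) :
  block_mx 1%:M 0 B 1%:M \in unitmx.
Proof. by rewrite unitmxE det_lblock !det1 mulr1 unitr1. Qed.

Lemma unitmx_ublock (n p : nat) (B : 'M[R]_(n, p)) :
  block_mx 1%:M B 0 1%:M \in unitmx.
Proof. by rewrite unitmxE det_ublock !det1 mulr1 unitr1. Qed.

(** Completing the square in the second variable. Kept as an identity, apart from any definiteness,
    because [dualization] applies it to an indefinite matrix. *)
Lemma block_mx_schur_dr (n p : nat) (A : 'M[R]_n) (B : 'M[R]_(n, p))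
    (C : 'M[R]_p) (L := block_mx 1%:M 0 (invmx C *m B^T) 1%:M) :
  C^T = C -> C \in unitmx ->
  block_mx A B B^T C =
    L^T *m block_mx (A - B *m invmx C *m B^T) 0 0 C *m L.
Proof.
move=> sC uC; rewrite /L tr_block_mx !mulmx_block !trmx1 trmx0.
rewrite trmx_mul trmxK trmx_inv sC.
rewrite !(mulmx0, mul0mx, mul1mx, mulmx1, addr0, add0r).
by rewrite !mulmxA mulmxKV // mulmxV // mul1mx subrK.
Qed.

Lemma schur_dr (n p : nat) (A : 'M[R]_n) (B : 'M[R]_(n, p)) (C : 'M[R]_p) :
  posdefmx C ->
  psdmx (block_mx A B B^T C) <-> psdmx (A - B *m invmx C *m B^T).
Proof.
move=> dC; have uC := posdefmx_unit dC; have [sC _] := dC.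
rewrite block_mx_schur_dr // psdmx_congr_unit ?unitmx_lblock //.
rewrite psdmx_block_diag; split=> [[] //|h]; split=> //; exact: posdefmx_psd.
Qed.

Lemma schur_ul (n p : nat) (A : 'M[R]_n) (B : 'M[R]_(n, p)) (C : 'M[R]_p) :
  posdefmx A ->
  psdmx (block_mx A B B^T C) <-> psdmx (C - B^T *m invmx A *m B).
Proof.
move=> dA; have uA := posdefmx_unit dA; have [sA _] := dA.
pose L := block_mx 1%:M (invmx A *m B) 0 1%:M : 'M[R]_(n + p).
have -> : block_mx A B B^T C =
    L^T *m block_mx A 0 0 (C - B^T *m invmx A *m B) *m L.
  rewrite /L tr_block_mx !mulmx_block !trmx1 trmx0 trmx_mul trmx_inv sA.
  rewrite !(mulmx0, mul0mx, mul1mx, mulmx1, addr0, add0r).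
  by rewrite !mulmxA mulmxKV // mulmxV // mul1mx addrC subrK.
rewrite psdmx_congr_unit ?unitmx_ublock // psdmx_block_diag.
by split=> [[] //|h]; split=> //; exact: posdefmx_psd.
Qed.

(** * Exchange of Schur complements and duality of quadratic inequalities *)

Lemma psdmx_schur_swap (n p : nat) (A : 'M[R]_n) (B : 'M[R]_(n, p))
    (C : 'M[R]_p) :
  posdefmx A -> posdefmx C ->
  psdmx (A - B *m invmx C *m B^T) <-> psdmx (C - B^T *m invmx A *m B).
Proof. by move=> dA dC; rewrite -schur_dr // schur_ul. Qed.

(** A - B and B^-1 - A^-1 are the two Schur complements of [[A, I], [I, B^-1]]. *)
Lemma loewner_le_inv (n : nat) (A B : 'M[R]_n) :
  posdefmx A -> posdefmx B ->
  loewner_le B A <-> loewner_le (invmx A) (invmx B).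
Proof.
move=> dA dB; have := psdmx_schur_swap 1%:M dA (posdefmx_inv dB).
by rewrite /loewner_le invmxK trmx1 !mul1mx !mulmx1.
Qed.

(* Writing [V = C^-1 B], [S = B^T C^-1 B - A] and [X = W + V], the two forms are
   [S - X^T C X] and [C^-1 - X S^-1 X^T], i.e. the two Schur complements of
   [[S, X^T], [X, C^-1]]. *)
Lemma dualization (p q : nat) (A : 'M[R]_p) (B : 'M[R]_(q, p)) (C : 'M[R]_q)
    (Nt : 'M[R]_(p + q)) (W : 'M[R]_(q, p)) :
  negdefmx A -> posdefmx C -> block_mx A B^T B C *m Nt = 1%:M ->
  loewner_le ((col_mx 1%:M W)^T *m block_mx A B^T B C *m col_mx 1%:M W) 0 <->
  psdmx (row_mx (- W) 1%:M *m Nt *m (row_mx (- W) 1%:M)^T).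
Proof.
move=> dA dC NNt; have uC := posdefmx_unit dC; have [sC _] := dC.
pose S := - A + B^T *m invmx C *m B; pose X := W + invmx C *m B.
have dS : posdefmx S.
  exact/posdefmxD_psd/psdmx_congr/posdefmx_psd/posdefmx_inv.
have uS := posdefmx_unit dS.
pose L := block_mx 1%:M 0 (invmx C *m B) 1%:M : 'M[R]_(p + q).
have uL : L \in unitmx by apply: unitmx_lblock.
have LE : block_mx A B^T B C = L^T *m block_mx (- S) 0 0 C *m L.
  have := @block_mx_schur_dr _ _ A B^T C sC uC; rewrite trmxK => ->.
  by rewrite /S opprD opprK.
pose Di := block_mx (- invmx S) 0 0 (invmx C).
have DDi : block_mx (- S) 0 0 C *m Di = 1%:M.
  rewrite mulmx_block !(mulmx0, mul0mx, addr0, add0r) mulmxN mulNmx opprK.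
  by rewrite !mulmxV // -scalar_mx_block.
(* A right inverse of a square matrix is unique, so [Nt] is the inverse of L^T diag(-S, C) L taken
   factor by factor. *)
have -> : Nt = invmx L *m Di *m (invmx L)^T.
  apply: (can_inj (mulKmx (mulmx1_unit NNt).1)); rewrite NNt LE.
  rewrite -!mulmxA mulKVmx // (mulmxA _ Di) DDi mul1mx trmx_inv.
  by rewrite mulmxV ?unitmx_tr.
(* [L] carries the graph of [W] to the graph of [X]; its inverse turns the annihilator of the first
   graph into that of the second. *)
have LW : L *m col_mx 1%:M W = col_mx 1%:M X.
  by rewrite mul_block_col !(mulmx1, mul1mx, mul0mx) addr0 [_ + W]addrC.
have WL : row_mx (- W) 1%:M *m invmx L = row_mx (- X) 1%:M.
  apply: (can_inj (mulmxK uL)); rewrite mulmxKV // mul_row_block.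
  by rewrite !(mulmx1, mul1mx, mulmx0) add0r opprD subrK.
have -> : row_mx (- W) 1%:M *m (invmx L *m Di *m (invmx L)^T)
    *m (row_mx (- W) 1%:M)^T = invmx C - X *m invmx S *m X^T.
  rewrite -!mulmxA -trmx_mul WL !mulmxA WL mul_row_block tr_row_mx mul_row_col.
  rewrite !(mulmx0, mul1mx, addr0, add0r) trmx1 mulmx1.
  by rewrite [(- X)^T]linearN /= !mulmxN !mulNmx !opprK [RHS]addrC.
have -> : (col_mx 1%:M W)^T *m block_mx A B^T B C *m col_mx 1%:M W
    = - (S - X^T *m C *m X).
  rewrite LE !mulmxA -trmx_mul -!mulmxA LW !mulmxA tr_col_mx mul_row_block.
  rewrite mul_row_col trmx1 !(mulmx0, mul1mx, mulmx1, addr0, add0r).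
  by rewrite opprB addrC.
have := psdmx_schur_swap X^T dS (posdefmx_inv dC).
by rewrite /loewner_le sub0r opprK invmxK trmxK.
Qed.

(** The first two blocks merge into the negative definite diag(-P, A), so [dualization] applies to
    the graph of (W D). As P is decoupled from the other blocks, its inverse contributes exactly - W
    P^-1 W^T to the dual form. *)
Lemma dualization_outer (p l q : nat) (P : 'M[R]_p) (A : 'M[R]_l)
    (U : 'M[R]_(q, l)) (C : 'M[R]_q) (Mt : 'M[R]_(l + q))
    (W : 'M[R]_(q, p)) (D : 'M[R]_(q, l))
    (E := col_mx (row_mx 1%:M 0) (col_mx (row_mx 0 1%:M) (row_mx W D))) :
  posdefmx P -> negdefmx A -> posdefmx C ->
  block_mx A U^T U C *m Mt = 1%:M ->
  loewner_le (E^T *m block_mx (- P) 0 0 (block_mx A U^T U C) *m E) 0 <->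
  psdmx (row_mx (- D) 1%:M *m Mt *m (row_mx (- D) 1%:M)^T
         - W *m invmx P *m W^T).
Proof.
move=> dP dA dC; have uP := posdefmx_unit dP.
rewrite -[Mt]submxK; set a := ulsubmx _; set b := ursubmx _.
set c := dlsubmx _; set d := drsubmx _ => MMt.
have dPA : negdefmx (block_mx (- P) 0 0 A).
  rewrite /negdefmx opp_block_mx opprK !oppr0; exact: posdefmx_block_diag.
have NNt : block_mx (block_mx (- P) 0 0 A) (row_mx 0 U)^T (row_mx 0 U) C
    *m block_mx (block_mx (- invmx P) 0 0 a) (col_mx 0 b) (row_mx 0 c) d = 1%:M.
  move: MMt; rewrite mulmx_block scalar_mx_block => /eq_block_mx [e1 e2 e3 e4].
  rewrite mulmx_block tr_row_mx trmx0 mulmx_block !mul_block_col !mul_row_block.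
  rewrite !mul_col_row !mul_mx_row !mul_col_mx mul_row_col.
  rewrite !(mulmx0, mul0mx, addr0, add0r) add_block_mx add_col_mx add_row_mx.
  rewrite !(mulmx0, mul0mx, addr0, add0r) e1 e2 e3 e4.
  by rewrite mulmxN mulNmx opprK mulmxV // -!scalar_mx_block row_mx0 col_mx0
    -!scalar_mx_block.
have := dualization (row_mx W D) dPA dC NNt.
(* The groupings p + (l + q) and (p + l) + q give different matrix types, so the two forms are
   compared by full block expansion. *)
have -> : (col_mx 1%:M (row_mx W D))^T
    *m block_mx (block_mx (- P) 0 0 A) (row_mx 0 U)^T (row_mx 0 U) C
    *m col_mx 1%:M (row_mx W D)
  = E^T *m block_mx (- P) 0 0 (block_mx A U^T U C) *m E.
  rewrite /E !(tr_col_mx, tr_row_mx, trmx0, trmx1).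
  rewrite !(mul_row_block, mul_row_col, mul_col_mx, mul_mx_row, mul_block_col).
  rewrite !(mulmx0, mul0mx, mulmx1, mul1mx, addr0, add0r, row_mx0, col_mx0).
  rewrite mul_row_col !mul_mx_row mulmx0 mulmx1 -block_mxEv !block_mxEh col_mx0.
  by rewrite !add_row_mx !add0r !addr0.
have -> // : row_mx (- row_mx W D) 1%:M
    *m block_mx (block_mx (- invmx P) 0 0 a) (col_mx 0 b) (row_mx 0 c) d
    *m (row_mx (- row_mx W D) 1%:M)^T
  = row_mx (- D) 1%:M *m block_mx a b c d *m (row_mx (- D) 1%:M)^T
    - W *m invmx P *m W^T.
  rewrite opp_row_mx !(tr_col_mx, tr_row_mx, trmx0, trmx1).
  rewrite !(mul_row_block, mul_row_col, mul_col_mx, mul_mx_row, mul_block_col).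
  rewrite !(mulmx0, mul0mx, mulmx1, mul1mx, addr0, add0r, row_mx0, col_mx0).
  rewrite [(- W)^T]linearN mulNmx mulmxN opprK add_row_mx addr0 mul_row_col.
  by rewrite mulmxN -addrA addrC.
Qed.

End Definiteness.

(** * Inverse of the middle matrix and the change of gain variables *)

(** Up to a permutation of blocks the middle matrix is diag(M, P, I), which is inverted block by
    block. *)
Lemma mid_mx_inv (R : realType) (n l r q : nat)
    (M : 'M[R]_(r + l)) (P : 'M[R]_(1 + n)) :
  M \in unitmx -> P \in unitmx ->
  mid_mx q M P *m mid_mx q (invmx M) (invmx P) = 1%:M.
Proof.
move=> uM uP; have := mulmxV uM; rewrite -{1}[M]submxK -{1}[invmx M]submxK.
rewrite mulmx_block scalar_mx_block => /eq_block_mx [e11 e12 e21 e22].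
rewrite /mid_mx !(mulmx_block, mul_block_col, mul_row_block, mul_row_col).
rewrite !(mul_mx_row, mul_col_mx, mul_block_col, mul_row_block, mulmx_block).
rewrite !(mulmx0, mul0mx, mulmx1, mul1mx, addr0, add0r, row_mx0, col_mx0).
(* The product of the M12 column and the M~21 row fills only the last diagonal corner, where it
   completes M11 M~11 to the identity. *)
have row_col_block (x : 'M[R]_r) :
    row_mx (0 : 'M_(_, 1 + n)) (row_mx (0 : 'M_(_, q))
      (col_mx (0 : 'M_(1 + n, _)) (col_mx (0 : 'M_(q, _)) x)))
    = block_mx 0 0 0 (block_mx 0 0 0 x).
  rewrite !block_mxEh !col_mx0 -[X in col_mx X (row_mx _ _)]row_mx0.
  by rewrite -block_mxEv block_mxEh col_mx0.
rewrite row_col_block !(add_row_mx, add_col_mx, add_block_mx, addr0, add0r).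
rewrite [drsubmx M *m drsubmx _ + _]addrC e22 [drsubmx M *m dlsubmx _ + _]addrC.
rewrite e21 [ursubmx M *m drsubmx _ + _]addrC e12.
rewrite [ursubmx M *m dlsubmx _ + _]addrC e11.
by rewrite mulmxV // !row_mx0 !col_mx0 -!block_mxEv -!scalar_mx_block.
Qed.

(** The substitution K~ = K P~ turns a closed-loop row multiplied by P~ into an expression linear in
    (P~, K~). *)
Lemma loop_row_mulr (R : realType) (n m p : nat) (h : 'cV[R]_p)
    (H : 'M[R]_(p, n)) (G : 'M[R]_(p, m)) (X : 'M[R]_(1 + n))
    (K : 'M[R]_(m, 1 + n)) :
  loop_row h H G X (K *m X) = loop_row h H G 1%:M K *m X.
Proof. by rewrite /loop_row -mulmxA mul_col_mx mul1mx. Qed.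

(** * The robust decrease condition and the output bounds *)

Section LoopInequalities.
Variables (R : realType) (N n m l r s : nat).
Variables (q : 'I_N -> nat) (t : 'I_N -> 'I_s -> nat).
Variable sys : @uncertain_system R N n m l r s q t.
Variables (k : 'I_N) (K : 'M[R]_(m, 1 + n)) (P : 'M[R]_(1 + n)).

(** The rows of E_k below its identity rows are (W D), with W acting on (1, x) and D on the
    disturbance; [T_mx] unfolds to [row_mx (- D) 1%:M]. *)
Let W : 'M[R]_((1 + n) + (q k + r), 1 + n) :=
  col_mx (col_mx (e0 R n) (rowF sys k 1%:M K))
         (col_mx (rowG1 sys k 1%:M K) (rowG3 sys k 1%:M K)).
Let D : 'M[R]_((1 + n) + (q k + r), l) :=
  col_mx (col_mx 0 (sys_B2 sys k)) (col_mx (sys_D12 sys k) (sys_D32 sys k)).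

Lemma E_mxE :
  E_mx sys k K = col_mx (row_mx 1%:M 0) (col_mx (row_mx 0 1%:M) (row_mx W D)).
Proof.
by rewrite /E_mx /W /D -(@block_mxEh _ _ _ _ _ (col_mx _ _)) !block_mxEv
  -!block_mxEh !block_mxEv.
Qed.

(** [e0] extracts the first row of [X]; the other rows follow from the change of gain variables. *)
Lemma Y_tildeE X : Y_tilde sys k X (K *m X) = W *m X.
Proof.
rewrite /Y_tilde /rowF /rowG1 /rowG3 !loop_row_mulr /W !mul_col_mx.
congr (col_mx (col_mx _ _) _).
by rewrite -{2}[X]vsubmxK mul_row_col mul1mx mul0mx addr0.
Qed.

(** In the Schur complement with respect to P~, the term Y~ P~^-1 Y~^T collapses to W P^-1 W^T, the
    term subtracted in [dualization_outer]. *)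
Lemma robust_decrease_lmi (M : 'M[R]_(r + l)) (Pnext : 'M[R]_(1 + n)) :
  posdefmx P -> posdefmx Pnext -> M^T = M -> M \in unitmx ->
  posdefmx (ulsubmx M) -> negdefmx (drsubmx M) ->
  loewner_le ((E_mx sys k K)^T *m N_mx (q k) M P Pnext *m E_mx sys k K) 0 <->
  psdmx (block_mx (Q_tilde sys k (invmx M) (invmx Pnext))
           (Y_tilde sys k (invmx P) (K *m invmx P))
           (Y_tilde sys k (invmx P) (K *m invmx P))^T (invmx P)).
Proof.
move=> dP dPn sM uM dM1 dM2; have uP := posdefmx_unit dP.
have [sPi _] := posdefmx_inv dP.
rewrite schur_dr; last exact: posdefmx_inv.
rewrite Y_tildeE invmxK trmx_mul sPi !mulmxA mulmxKV // E_mxE.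
(* Symmetry of [M] makes the upper right block the transpose of the lower left one, as the duality
   lemma requires. *)
have midE : mid_mx (q k) M Pnext =
    block_mx (drsubmx M) (col_mx 0 (col_mx 0 (ursubmx M)))^T
      (col_mx 0 (col_mx 0 (ursubmx M)))
      (block_mx Pnext 0 0 (block_mx 1%:M 0 0 (ulsubmx M))).
  rewrite /mid_mx !tr_col_mx !trmx0.
  congr (block_mx _ (row_mx _ (row_mx _ _)) _ _).
  by rewrite -{1}sM trmx_ursub.
have := mid_mx_inv (q k) uM (posdefmx_unit dPn).
rewrite /N_mx {1 2}midE; apply: dualization_outer => //.
do 2!apply: posdefmx_block_diag => //.
exact: posdefmx_scalar ltr01.
Qed.

(** Eliminating the block nu^-1 I leaves P~ - nu G~^T G~ with G~ = G P~, which is the congruence of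
    P - nu G^T G by P~. *)
Lemma output_bound_lmi (nu : R) (i : 'I_s) : posdefmx P -> 0 < nu ->
  loewner_le (nu *: ((rowG2 sys k 1%:M K i)^T *m rowG2 sys k 1%:M K i)) P <->
  psdmx (block_mx (invmx P) (rowG2 sys k (invmx P) (K *m invmx P) i)^T
           (rowG2 sys k (invmx P) (K *m invmx P) i) (nu^-1)%:M).
Proof.
move=> dP nu0; have uP := posdefmx_unit dP; have [sPi _] := posdefmx_inv dP.
rewrite /rowG2 loop_row_mulr; set G := loop_row _ _ _ _ _.
have dnu : posdefmx ((nu^-1)%:M : 'M[R]_(t k i)).
  by apply: posdefmx_scalar; rewrite invr_gt0.
have := schur_dr (invmx P) (G *m invmx P)^T dnu; rewrite trmxK => ->.
have -> : invmx P - (G *m invmx P)^T *m invmx (nu^-1)%:M *m (G *m invmx P)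
    = (invmx P)^T *m (P - nu *: (G^T *m G)) *m invmx P.
  rewrite invmx_scalar invrK mul_mx_scalar trmx_mul sPi.
  rewrite mulmxBr mulmxBl mulVmx // mul1mx; congr (_ - _).
  by rewrite -!scalemxAl -scalemxAr -scalemxAl !mulmxA.
by rewrite psdmx_congr_unit ?unitmx_inv.
Qed.

End LoopInequalities.

(** * The trace condition and the assembly of the four equivalences *)

Lemma trace_bound_lmi (R : realType) (n : nat) (P Sigma S : 'M[R]_n) (nu : R) :
  posdefmx P -> psd_sqrt_of Sigma S -> 0 < nu ->
  let Z := nu ^- 2 *: (S *m P *m S) in
  \tr (P *m Sigma) <= nu <->
  psdmx (block_mx (invmx P) (nu^-1 *: S) (nu^-1 *: S)^T Z) /\ \tr Z <= nu^-1.
Proof.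
move=> dP [[sS _] SS] nu0 Z.
(* Cyclicity of the trace and S S = Sigma give tr Z = nu^-2 tr(P Sigma); the factor nu^2 turns the
   bound nu^-1 into nu. *)
have trZ : \tr Z <= nu^-1 = (\tr (P *m Sigma) <= nu).
  rewrite mxtraceZ -mulmxA mxtrace_mulC -mulmxA SS.
  by rewrite mulrC ler_pdivrMr ?exprn_gt0 // expr2 mulKf ?gt_eqF.
split=> [h|[_]]; last by rewrite trZ.
split; last by rewrite trZ.
rewrite schur_ul; last exact: posdefmx_inv.
have -> : (nu^-1 *: S)^T = nu^-1 *: S by rewrite linearZ /= sS.
(* Z equals (nu^-1 S) P (nu^-1 S), so the Schur complement is zero. *)
rewrite invmxK /Z -!scalemxAl -scalemxAr scalerA -invfM -expr2 subrr.
by split=> [|x]; rewrite ?trmx0 // mulmx0 mul0mx mxE.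
Qed.

Theorem theorem3 (R : realType) (N n m l r s : nat)
    (q : 'I_N -> nat) (t : 'I_N -> 'I_s -> nat)
    (sys : @uncertain_system R N n m l r s q t)
    (xbar : 'cV[R]_n) (sqrtSigma0 : 'M[R]_(1 + n))
    (h_sqrt : psd_sqrt_of (Sigma0 xbar) sqrtSigma0)
    (Pf : 'M[R]_(1 + n)) (h_Pf : posdefmx Pf)
    (cone cone' : set 'M[R]_(r + l)) (h_cone : multiplier_cone cone cone')
    (M : 'I_N -> 'M[R]_(r + l)) (h_M : forall k, cone (M k))
    (P : 'I_N.+1 -> 'M[R]_(1 + n)) (h_P : forall k, posdefmx (P k))
    (K : 'I_N -> 'M[R]_(m, 1 + n))
    (nu : R) (h_nu : 0 < nu) :
  let Pt (k : 'I_N.+1) : 'M[R]_(1 + n) := invmx (P k) in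
  let Kt (k : 'I_N) : 'M[R]_(m, 1 + n) := K k *m invmx (P (idx k)) in
  let nut := nu^-1 in
  let Z : 'M[R]_(1 + n) := nu ^- 2 *: (sqrtSigma0 *m P ord0 *m sqrtSigma0) in
  let Mt (k : 'I_N) : 'M[R]_(r + l) := invmx (M k) in
  let R1 := forall k : 'I_N,
    loewner_le ((E_mx sys k (K k))^T *m N_mx (q k) (M k) (P (idx k)) (P (idxS k))
                  *m E_mx sys k (K k)) 0 in
  let P2 := \tr (P ord0 *m Sigma0 xbar) <= nu in
  let P3 := loewner_le Pf (P ord_max) in
  let P4 := forall (k : 'I_N) (i : 'I_s),
    loewner_le (nu *: ((rowG2 sys k 1%:M (K k) i)^T *m rowG2 sys k 1%:M (K k) i))
               (P (idx k)) in
  let LR1 := forall k : 'I_N,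
    psdmx (block_mx (Q_tilde sys k (Mt k) (Pt (idxS k)))
                    (Y_tilde sys k (Pt (idx k)) (Kt k))
                    (Y_tilde sys k (Pt (idx k)) (Kt k))^T
                    (Pt (idx k))) in
  let L2 :=
    psdmx (block_mx (Pt ord0) (nut *: sqrtSigma0) (nut *: sqrtSigma0)^T Z)
    /\ \tr Z <= nut in
  let L3 := loewner_le (Pt ord_max) (invmx Pf) in
  let L4 := forall (k : 'I_N) (i : 'I_s),
    psdmx (block_mx (Pt (idx k)) (rowG2 sys k (Pt (idx k)) (Kt k) i)^T
                    (rowG2 sys k (Pt (idx k)) (Kt k) i) (nut%:M)) in
  [/\ R1, P2, P3 & P4] <-> [/\ LR1, L2, L3 & L4].

Proof.
move=> Pt Kt nut Z Mt R1 P2 P3 P4 LR1 L2 L3 L4.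
have [_ _ hM] := h_cone.
(* Membership in the cone supplies the symmetry, invertibility and block signs of each M_k on which
   duality rests. *)
have e1 : R1 <-> LR1.
  by split=> h k; have [sM uM d1 d2 _] := hM _ (h_M k);
    apply/(robust_decrease_lmi sys k (K k) (h_P (idx k)) (h_P (idxS k)) sM uM d1 d2).
have e2 : P2 <-> L2 by exact: trace_bound_lmi.
have e3 : P3 <-> L3 by exact: loewner_le_inv.
have e4 : P4 <-> L4.
  by split=> h k i; apply/(output_bound_lmi sys k (K k) i (h_P (idx k)) h_nu).
by split=> -[h1 h2 h3 h4];
  (split; [exact/e1|exact/e2|exact/e3|exact/e4]).
Qed.
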